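(* Let $m,n\ge0$, $A\subseteq\{1,\dots,m+n\}$ with $|A|=n$, and $w\in S_{m+n}$. Then $\mathrm{Dela}_A(\chi^w)=\chi^{w_{\le m}}\otimes\chi^{w_{>m}}$ if $w^{-1}(A)=\{m+1,\dots,m+n\}$, and $\mathrm{Dela}_A(\chi^w)=0$ otherwise.
   Context: Let $q$ be a prime power, $\mathfrak{ut}_N$ the additive group of strictly upper triangular $N\times N$ matrices over $\mathbb{F}_q$, $e_{ij}(t)$ the matrix with $t$ at $(i,j)$ and zeros elsewhere. For $w\in S_N$ (one-line notation), $\iota_k(w)=\#\{i<w^{-1}(k):w(i)>k\}$ and $\mathfrak{ut}_w=\{x\in\mathfrak{ut}_N:x_{ij}\ne0\Rightarrow0<j-i\le\iota_i(w)\}$. These subgroups form a lattice (closed under intersection and sum); its normal lattice supercharacter theory has supercharacters $\chi^w=\sum_\psi\psi(1)\psi$, summed over irreducible characters $\psi$ of $\mathfrak{ut}_N$ such that $\mathfrak{ut}_w$ is the largest lattice member contained in $\ker\psi$; $\mathrm{scf}(\mathfrak{ut}_N)$ is their span. With $N=m+n$, $|A|=n$: for $1\le i<j\le N$ let $c_i=N-\#\{a\in A:a>i\}$, $U_A=\{(i,j):i\in A,j>c_i\}$, $L_A=\{(i,j):i\in A,j\le c_i\}$, $U_A^\vee=\{(i,j):i\notin A,j\le c_i\}$, $R_A=\{(i,j):i\notin A,j>c_i\}$, and $\mathfrak{ut}_A,\mathfrak{l}_A,\mathfrak{ut}_A^\vee,\mathfrak{r}_A$ the subgroups of matrices supported there.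 Identify $\mathfrak{ut}_A^\vee\cong\mathfrak{ut}_m$ via $e_{ij}(t)\mapsto e_{i-k,j-k}(t)$, $k=\#\{a\in A:a<i\}$, and $\mathfrak{ut}_A\cong\mathfrak{ut}_n$ via $e_{ij}(t)\mapsto e_{i-\#\{b<i:b\notin A\},j-m}(t)$, so functions on $\mathfrak{ut}_A^\vee\times\mathfrak{ut}_A$ are elements of functions on $\mathfrak{ut}_m\times\mathfrak{ut}_n$. Delapsing: for $\gamma\in\mathrm{scf}(\mathfrak{ut}_N)$, $\mathrm{Dela}_A(\gamma)(u',u)=q^{-|L_A|-|R_A|}\sum_{l\in\mathfrak{l}_A,r\in\mathfrak{r}_A}\left(\frac{-1}{q-1}\right)^{\#\{(i,j):r_{ij}\ne0\}}\gamma(l+u'+u+r)$. For $w\in S_{m+n}$: $w_{\le m}(i)=w(i)-\#\{j>m:w(j)<w(i)\}$ ($1\le i\le m$) and $w_{>m}(j)=w(j+m)-\#\{i\le m:w(i)<w(j+m)\}$ ($1\le j\le n$), i.e. the standardizations of the first $m$ and last $n$ letters. *)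

(* Defs.v *)
From HB Require Import structures.
From mathcomp Require Import all_boot all_order all_algebra all_fingroup all_field all_character.
Set Implicit Arguments. Unset Strict Implicit. Unset Printing Implicit Defensive.
Import GRing.Theory Num.Theory.

Lemma card_ord_lt N k : k <= N -> #|[set v : 'I_N | v < k]| = k.
Proof.
move=> kN.
have -> : [set v : 'I_N | v < k] = widen_ord kN @: [set: 'I_k].
  apply/setP=> v; rewrite inE; apply/idP/imsetP => [vk|[u _ ->]]; last by rewrite /= ltn_ord.
  by exists (Ordinal vk) => //; apply: val_inj.
by rewrite card_imset ?cardsT ?card_ord //; by move=> a b /(congr1 val) /= /val_inj.
Qed.

Lemma card_lt_perm N (w : 'S_N) x : #|[set y | w y < w x]| = w x.
Proof.
have -> : [set y | w y < w x] = (w^-1)%g @: [set v : 'I_N | v < w x].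
  apply/setP=> y; rewrite inE; apply/idP/imsetP => [h|[v]].
    by exists (w y); rewrite ?inE // permK.
  by rewrite inE => h ->; rewrite permKV.
by rewrite card_imset ?card_ord_lt 1?ltnW ?ltn_ord //; apply: perm_inj.
Qed.

Section Std.
Variables (N p : nat) (w : 'S_N) (f : 'I_p -> 'I_N) (finj : injective f).

Definition stdcnt (i : 'I_p) : nat := #|[set j : 'I_p | w (f j) < w (f i)]|.

Lemma stdcnt_lt i : stdcnt i < p.
Proof.
rewrite /stdcnt; have : [set j : 'I_p | w (f j) < w (f i)] \proper [set: 'I_p].
  by apply/properP; split; [exact: subsetT | exists i; rewrite ?inE ?ltnn].
by move/proper_card; rewrite cardsT card_ord.
Qed.

Lemma stdcnt_inj : injective (fun i => Ordinal (stdcnt_lt i)).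
Proof.
have key a b : w (f a) < w (f b) -> stdcnt a < stdcnt b.
  move=> ab; apply: proper_card; apply/properP; split.
    by apply/subsetP=> y; rewrite !inE => h; apply: ltn_trans ab.
  by exists a; rewrite !inE ?ltnn.
move=> a b /(congr1 val) /= e; case: (ltngtP (w (f a)) (w (f b))) => h.
- by move: (key _ _ h); rewrite e ltnn.
- by move: (key _ _ h); rewrite e ltnn.
- by apply: finj; apply: perm_inj; apply: val_inj; exact: h.
Qed.

Lemma stdcntE (Q : pred 'I_N) i :
  (forall y, ~~ Q y = (y \in [set f j | j in [set: 'I_p]])) ->
  w (f i) - #|[set y | Q y && (w y < w (f i))]| = stdcnt i.
Proof.
move=> hQ.
have -> : [set y | Q y && (w y < w (f i))] = [set y | w y < w (f i)] :&: [set y | Q y].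
  by apply/setP=> y; rewrite !inE andbC.
rewrite -[X in X - _](card_lt_perm w (f i)) -(cardsID [set y | Q y] [set y | w y < w (f i)]) addKn.
have -> : [set y | w y < w (f i)] :\: [set y | Q y] = f @: [set j : 'I_p | w (f j) < w (f i)].
  apply/setP=> y; rewrite !inE; apply/idP/imsetP => [/andP [nQ lt]|[j]].
    by move: nQ; rewrite hQ => /imsetP [j _ ey]; exists j; rewrite ?inE -?ey.
  rewrite inE => lt ->; rewrite lt andbT hQ; exact: imset_f.
by rewrite card_imset.
Qed.
End Std.

Section Standardize.
Variables (m n : nat) (w : 'S_(m + n)).

Definition stdlo_val (i : 'I_m) : nat :=
  w (lshift n i) - #|[set j : 'I_(m + n) | (m <= j) && (w j < w (lshift n i))]|.
Definition stdhi_val (j : 'I_n) : nat :=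
  w (rshift m j) - #|[set i : 'I_(m + n) | (i < m) && (w i < w (rshift m j))]|.

Lemma lshift_injn : injective (@lshift m n).
Proof. by move=> a b /(congr1 val) /= /val_inj. Qed.
Lemma rshift_injn : injective (@rshift m n).
Proof. by move=> a b /(congr1 val) /= /addnI /val_inj. Qed.

Lemma stdlo_valE i : stdlo_val i = stdcnt w (@lshift m n) i.
Proof.
apply: (stdcntE _ lshift_injn) => y; apply/idP/imsetP => [h|[j _ ->]].
  by rewrite -ltnNge in h; exists (Ordinal h) => //; apply: val_inj.
by rewrite /= -ltnNge ltn_ord.
Qed.

Lemma stdhi_valE j : stdhi_val j = stdcnt w (@rshift m n) j.
Proof.
apply: (stdcntE _ rshift_injn) => y; apply/idP/imsetP => [h|[i _ ->]].
  rewrite -leqNgt in h; have hy : y - m < n by rewrite ltn_subLR // ltn_ord.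
  by exists (Ordinal hy) => //; apply: val_inj; rewrite /= subnKC.
by rewrite /= -leqNgt leq_addr.
Qed.

Lemma stdlo_lt i : stdlo_val i < m.
Proof. by rewrite stdlo_valE; apply: stdcnt_lt. Qed.
Lemma stdhi_lt j : stdhi_val j < n.
Proof. by rewrite stdhi_valE; apply: stdcnt_lt. Qed.

Lemma stdlo_inj : injective (fun i => Ordinal (stdlo_lt i)).
Proof.
move=> a b /(congr1 val) /=; rewrite !stdlo_valE => e.
by apply: (@stdcnt_inj _ _ w _ (@lshift_injn)); apply: val_inj; exact: e.
Qed.
Lemma stdhi_inj : injective (fun j => Ordinal (stdhi_lt j)).
Proof.
move=> a b /(congr1 val) /=; rewrite !stdhi_valE => e.
by apply: (@stdcnt_inj _ _ w _ (@rshift_injn)); apply: val_inj; exact: e.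
Qed.

Definition std_lo : 'S_m := perm stdlo_inj.
Definition std_hi : 'S_n := perm stdhi_inj.

Lemma std_loE i : val (std_lo i) = stdlo_val i.
Proof. by rewrite permE. Qed.
Lemma std_hiE j : val (std_hi j) = stdhi_val j.
Proof. by rewrite permE. Qed.
End Standardize.

Section Supercharacters.
Variable F : finFieldType.
Local Open Scope ring_scope.

Definition MG (N : nat) : finGroupType := FinRing.Lmodule_to_finGroup 'M[F]_(N, N).

Lemma MG_mulE N (x y : MG N) : (x * y)%g = (x + y :> 'M[F]_(N, N)).
Proof. by []. Qed.

Definition ut_set (N : nat) : {set MG N} :=
  [set x : MG N | [forall i : 'I_N, forall j : 'I_N,
                    (j <= i)%N ==> ((x : 'M[F]_(N, N)) i j == 0)]].

Lemma ut_group N : group_set (ut_set N).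
Proof.
apply/group_setP; split.
  by rewrite inE; apply/forallP=> i; apply/forallP=> j; rewrite mxE eqxx implybT.
move=> x y; rewrite !inE => /forallP hx /forallP hy.
apply/forallP=> i; apply/forallP=> j; apply/implyP=> hij; rewrite MG_mulE mxE.
by rewrite (eqP (implyP (forallP (hx i) j) hij)) (eqP (implyP (forallP (hy i) j) hij)) addr0.
Qed.
Canonical ut N := Group (ut_group N).

Definition iot N (w : 'S_N) (k : 'I_N) : nat :=
  #|[set i : 'I_N | (i < (w^-1)%g k)%N && (k < w i)%N]|.

Definition ut_w N (w : 'S_N) : {set MG N} :=
  [set x : MG N | [forall i : 'I_N, forall j : 'I_N,
     ((x : 'M[F]_(N, N)) i j != 0) ==> ((i < j)%N && (j - i <= iot w i)%N)]].

Definition largest_in_ker N (w : 'S_N) (psi : 'CF(ut N)) : bool :=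
  (ut_w w \subset cfker psi) &&
  [forall v : 'S_N, (ut_w v \subset cfker psi) ==> (ut_w v \subset ut_w w)].

Definition superchar N (w : 'S_N) : 'CF(ut N) :=
  \sum_(i : Iirr (ut N) | largest_in_ker w 'chi_i) ('chi_i 1%g) *: 'chi_i.

Section Delapse.
Variables (m n : nat) (A : {set 'I_(m + n)}).
Notation N := (m + n).
Notation pos := ('I_N * 'I_N)%type.

Definition cA (i : 'I_N) : nat := N - #|[set a in A | (i < a)%N]|.

(* 0-based: the paper's condition j <= c_i reads j+1 <= c_i, i.e. j < c_i *)
Definition U_A : {set pos} :=
  [set p : pos | (p.1 < p.2)%N && (p.1 \in A) && (cA p.1 <= p.2)%N].
Definition L_A : {set pos} :=
  [set p : pos | (p.1 < p.2)%N && (p.1 \in A) && (p.2 < cA p.1)%N].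
Definition Uv_A : {set pos} :=
  [set p : pos | (p.1 < p.2)%N && (p.1 \notin A) && (p.2 < cA p.1)%N].
Definition R_A : {set pos} :=
  [set p : pos | (p.1 < p.2)%N && (p.1 \notin A) && (cA p.1 <= p.2)%N].

Definition supported (S : {set pos}) : {set MG N} :=
  [set x : MG N | [forall i : 'I_N, forall j : 'I_N,
     ((x : 'M[F]_(N, N)) i j != 0) ==> ((i, j) \in S)]].
Definition l_A := supported L_A.
Definition r_A := supported R_A.

Definition getm p (M : 'M[F]_(p, p)) (a b : nat) : F :=
  if insub a is Some i then if insub b is Some j then M i j else 0 else 0.

(* ut_m ~ ut_A^vee : e_{ij}(t) <-> e_{i-k, j-k}(t), k = #{a in A : a < i} *)
Definition embv (u' : 'M[F]_(m, m)) : MG N :=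
  \matrix_(i < N, j < N)
    (if (i, j) \in Uv_A
     then getm u' (i - #|[set a in A | (a < i)%N]|) (j - #|[set a in A | (a < i)%N]|)
     else 0).

(* ut_n ~ ut_A : e_{ij}(t) <-> e_{i - #{b < i : b notin A}, j - m}(t) *)
Definition embA (u : 'M[F]_(n, n)) : MG N :=
  \matrix_(i < N, j < N)
    (if (i, j) \in U_A
     then getm u (i - #|[set b | (b \notin A) && (b < i)%N]|) (j - m)
     else 0).

Definition Dela (g : 'CF(ut N)) (u' : 'M[F]_(m, m)) (u : 'M[F]_(n, n)) : algC :=
  (#|F|%:R ^- (#|L_A| + #|R_A|)) *
  \sum_(l in l_A) \sum_(r in r_A)
     ((-1) / (#|F|%:R - 1)) ^+ #|[set p : pos | (r : 'M[F]_(N, N)) p.1 p.2 != 0]| *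
     g ((l : 'M[F]_(N, N)) + (embv u' : 'M[F]_(N, N)) + (embA u : 'M[F]_(N, N))
        + (r : 'M[F]_(N, N)) : MG N).
End Delapse.

Definition tensor m n (f : 'CF(ut m)) (g : 'CF(ut n)) (u' : 'M[F]_(m, m)) (u : 'M[F]_(n, n)) : algC :=
  f (u' : MG m) * g (u : MG n).
End Supercharacters.

(* Main.v *)
Require Import Defs.
From HB Require Import structures.
From mathcomp Require Import all_boot all_order all_algebra all_fingroup all_field all_character.
From mathcomp Require Import zify.
Set Implicit Arguments. Unset Strict Implicit. Unset Printing Implicit Defensive.
Import Order.TTheory GRing.Theory Num.Theory.

(** The characters whose kernel contains the group supported on a set S of positions sum,
    with their degrees, to x |-> \prod_(p not in S) q [x_p = 0]. The lattice is a product
    of chains, one per row, so Moebius inversion yields a closed formula for chi^w as a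
    product of local factors: in row k with critical column c_k = k + iota_k(w) + 1, the
    factor at column j is 1, q [y = 0] - 1 or q [y = 0] according to whether j < c_k, j =
    c_k or j > c_k. Delapsing then acts entry by entry: averaging over an entry of L_A
    gives 0 if its column is critical and 1 otherwise; the weighted average over an entry
    of R_A gives 0 if its column is before the critical one and 1 otherwise. With d_k the
    number of larger values to the right of k in w and s_k the number of elements of A
    above k, nothing vanishes iff d_k <= s_k on A and d_k >= s_k off A, which by downward
    induction on the values means that every value outside A precedes every value in A.
    The remaining factors are those of the two standardizations. *)

(** * Larger values to the left and to the right of a position *)

Definition asc N (w : 'S_N) (i : 'I_N) : nat :=
  #|[set j : 'I_N | (i < j) && (w i < w j)]|.

Lemma iotE N (w : 'S_N) i : iot w (w i) = #|[set j : 'I_N | (j < i) && (w i < w j)]|.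
Proof. by rewrite /iot permK. Qed.

Lemma card_ord_ge N k : #|[set v : 'I_N | k <= v]| = N - k.
Proof.
have [kN|Nk] := leqP k N; last first.
  rewrite (_ : [set _ | _] = set0) ?cards0; first by apply/esym/eqP; rewrite subn_eq0 ltnW.
  by apply/setP=> v; rewrite !inE; apply/negbTE; rewrite -ltnNge (leq_trans _ (ltnW Nk)).
have := cardsC [set v : 'I_N | v < k]; rewrite card_ord_lt // card_ord.
have -> : ~: [set v : 'I_N | v < k] = [set v : 'I_N | k <= v].
  by apply/setP=> v; rewrite !inE -leqNgt.
by move=> e; rewrite -[N in N - _]e addKn.
Qed.

(** Of the values above [w i], those left of position [i] are counted by [iot] and those right of it
    by [asc]; with indices from 0 there are [N - (w i).+1] in all. *)
Lemma iot_asc N (w : 'S_N) i : iot w (w i) + asc w i = N - (w i).+1.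
Proof.
rewrite iotE /asc -(card_ord_ge N (w i).+1).
rewrite -[RHS](card_imset _ (@perm_inj _ w^-1)%g).
rewrite -[RHS](cardsID [set j : 'I_N | j < i]).
congr (_ + _); apply: eq_card => j; rewrite !inE.
  rewrite [RHS]andbC; congr (_ && _); apply/idP/imsetP => [h|[x]].
    by exists (w j); rewrite ?inE ?permK.
  by rewrite inE => h ->; rewrite permKV.
have -> : (j \in (w^-1)%g @: [set v : 'I_N | w i < v]) = (w i < w j).
  apply/imsetP/idP => [[x]|h]; last by exists (w j); rewrite ?inE ?permK.
  by rewrite inE => h ->; rewrite permKV.
by rewrite -leqNgt [i <= j]leq_eqVlt; case: (eqVneq (i : nat) j) => [/ord_inj ->|_] /=; rewrite ?ltnn ?andbF.
Qed.

(** Inversion tables: the row lengths can be prescribed independently, which makes the lattice a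
    product of chains. *)
Lemma iot_surj N (c : 'I_N -> nat) :
  (forall k : 'I_N, c k + k < N) -> exists v : 'S_N, iot v =1 c.
Proof.
elim: N c => [|N IH] c hc; first by exists 1%g => -[].
have [v hv] : exists v : 'S_N, iot v =1 (fun k => c (lift ord0 k)).
  by apply: IH => k; have := hc (lift ord0 k); rewrite lift0 addnS ltnS.
have c0 : c ord0 < N.+1 by have := hc ord0; rewrite addn0.
(* The value 0 is inserted at position [c ord0], where every earlier letter is larger; being the
   smallest value, it changes no other count. *)
exists (lift_perm (Ordinal c0) ord0 v) => k.
have [i ->] : exists i, k = lift_perm (Ordinal c0) ord0 v i by exists ((lift_perm (Ordinal c0) ord0 v)^-1 k)%g; rewrite permKV.
rewrite iotE; case: (unliftP (Ordinal c0) i) => [i'|] ->; last first.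
  rewrite lift_perm_id -[RHS](card_ord_lt (ltnW c0)); apply: eq_card => j; rewrite !inE.
  case: (unliftP (Ordinal c0) j) => [j'|] ->; last by rewrite /= ltnn.
  by rewrite lift_perm_lift lift0 andbT.
rewrite lift_perm_lift -[RHS]hv iotE -(card_imset _ (@lift_inj _ (Ordinal c0))).
apply: eq_card => j; rewrite !inE; apply/andP/imsetP => [|[j']].
  case: (unliftP (Ordinal c0) j) => [j'|] ->; last by rewrite lift_perm_id /= ltn0 => -[].
  rewrite lift_perm_lift !lift0 ltnS => -[h1 h2]; exists j' => //; rewrite inE h2 andbT.
  by move: h1; rewrite /= /bump; case: leqP; case: leqP => /=; lia.
rewrite inE => /andP [h1 h2] ->; rewrite lift_perm_lift !lift0 ltnS; split=> //.
by rewrite /= /bump; case: leqP; case: leqP => /=; lia.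
Qed.

(** * Standardizations and shuffles *)

Lemma ltn_stdcnt N p (w : 'S_N) (f : 'I_p -> 'I_N) i j :
  injective f -> (stdcnt w f i < stdcnt w f j) = (w (f i) < w (f j)).
Proof.
move=> finj; have key a b : w (f a) < w (f b) -> stdcnt w f a < stdcnt w f b.
  move=> ab; apply: proper_card; apply/properP; split.
    by apply/subsetP=> y; rewrite !inE => h; apply: ltn_trans ab.
  by exists a; rewrite !inE ?ltnn.
apply/idP/idP; last exact: key.
case: (ltngtP (w (f i)) (w (f j))) => [//|/key|]; first by lia.
by move=> /val_inj/perm_inj/finj ->; rewrite ltnn.
Qed.

Section Shuffle.
Variables (m n : nat) (A : {set 'I_(m + n)}) (w : 'S_(m + n)).

Definition nabove (k : 'I_(m + n)) : nat := #|[set a in A | k < a]|.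

(** Downward induction on the smaller of the two values. Suppose [i < j]. If [w i] is smaller, all
    of [A] above it stands right of [j] by induction, and [j] is one ascent too many. If [w j] is
    smaller, every larger value right of [j] lies in [A], while [w i], on its left, is an element of
    [A] that is missed. *)
Lemma sorted_of_asc :
  (forall i, w i \in A -> asc w i <= nabove (w i)) ->
  (forall i, w i \notin A -> nabove (w i) <= asc w i) ->
  forall i j, w i \in A -> w j \notin A -> j < i.
Proof.
move=> hA hnA.
have aux d i j : m + n - minn (w i) (w j) <= d -> w i \in A -> w j \notin A -> j < i.
  elim: d i j => [|d IH] i j; first by have := ltn_ord (w i); lia.
  move=> hd iA jA; rewrite ltnNge; apply/negP => ij.
  have {ij}ij : i < j.
    rewrite ltn_neqAle ij andbT; apply: contraNneq jA => /val_inj e.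
    by rewrite -e.
  case: (ltngtP (w i) (w j)) => wij.
  - have := hA _ iA; rewrite leqNgt => /negP; apply.
    rewrite /nabove /asc -(card_imset _ (@perm_inj _ w^-1)%g).
    apply: proper_card; apply/properP; split.
      apply/subsetP => _ /imsetP [c + ->]; rewrite !inE permKV => /andP [cA ic].
      rewrite ic andbT; apply: (ltn_trans ij); apply: IH; rewrite ?permKV //; lia.
    exists j; first by rewrite inE ij.
    apply/imsetP => -[c]; rewrite inE => /andP [cA _] e.
    by move: jA; rewrite e permKV cA.
  - have := hnA _ jA; rewrite leqNgt => /negP; apply.
    rewrite /nabove /asc -[X in X < _](card_imset _ (@perm_inj _ w)).
    apply: proper_card; apply/properP; split.
      apply/subsetP => _ /imsetP [c + ->]; rewrite !inE => /andP [jc wjc].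
      rewrite wjc andbT; apply/idPn => cA.
      have : c < i by apply: IH => //; lia.
      by lia.
    exists (w i); first by rewrite inE iA.
    apply/imsetP => -[c]; rewrite inE => /andP [jc _] /perm_inj e.
    by move: jc; rewrite -e; lia.
  - by move: ij; rewrite (perm_inj (val_inj wij)) ltnn.
by move=> i j; apply: (aux (m + n - minn (w i) (w j))).
Qed.

(** An element of [A] at a position [i < m] would squeeze the [m] positions of values outside [A]
    into the [i] places before it. *)
Lemma shuffle_of_sorted :
  #|A| = n ->
  (forall i j, w i \in A -> w j \notin A -> j < i) ->
  [set i | w i \in A] = [set i : 'I_(m + n) | m <= i].
Proof.
move=> cardA hs.
have cW : #|[set i | w i \in A]| = n.
  rewrite -[RHS]cardA -[LHS](card_imset _ (@perm_inj _ w)).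
  apply: eq_card => a; apply/imsetP/idP => [[i + ->]|aA]; first by rewrite inE.
  by exists ((w^-1)%g a); rewrite ?inE permKV.
have cT : #|[set i : 'I_(m + n) | m <= i]| = n by rewrite card_ord_ge addKn.
have [//|[i []]] : [set i | w i \in A] = [set i : 'I_(m + n) | m <= i] \/
    exists i, w i \in A /\ i < m.
  case: (boolP [exists i, (w i \in A) && (i < m)]) => [/existsP [i /andP []]|h].
    by right; exists i.
  left; apply/eqP; rewrite eqEcard cW cT leqnn andbT; apply/subsetP=> i; rewrite !inE => wi.
  by rewrite leqNgt; apply: contra h => im; apply/existsP; exists i; rewrite wi.
move=> wi im.
have : [set i | w i \notin A] \subset [set j : 'I_(m + n) | j < i].
  by apply/subsetP => j; rewrite !inE; apply: hs.
move/subset_leq_card; rewrite card_ord_lt; last exact: ltnW.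
have := cardsC [set i | w i \in A]; rewrite card_ord cW.
rewrite (_ : ~: _ = [set i | w i \notin A]); first by lia.
by apply/setP=> j; rewrite !inE.
Qed.

Section Shuffled.
Hypothesis hW : forall i, (w i \in A) = (m <= i).

(** With the next lemma, the converse of [sorted_of_asc]: only elements of [A] stand right of an
    element of [A], and all of [A] stands right of any other value. *)
Lemma asc_le_nabove i : w i \in A -> asc w i <= nabove (w i).
Proof.
rewrite hW => mi; rewrite /asc /nabove -[X in X <= _](card_imset _ (@perm_inj _ w)).
apply: subset_leq_card; apply/subsetP => _ /imsetP [j + ->].
by rewrite !inE => /andP [ij ->]; rewrite hW andbT; lia.
Qed.

Lemma nabove_le_asc i : w i \notin A -> nabove (w i) <= asc w i.
Proof.
rewrite hW -ltnNge => im; rewrite /asc /nabove -[X in X <= _](card_imset _ (@perm_inj _ w^-1)%g).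
apply: subset_leq_card; apply/subsetP => _ /imsetP [a + ->].
rewrite !inE permKV => /andP [aA ->]; rewrite andbT.
by move: aA; rewrite -{1}(permKV w a) hW; lia.
Qed.

Lemma std_lo_mono i j : (std_lo w i < std_lo w j) = (w (lshift n i) < w (lshift n j)).
Proof. by rewrite !std_loE !stdlo_valE ltn_stdcnt //; apply: lshift_injn. Qed.

Lemma std_hi_mono i j : (std_hi w i < std_hi w j) = (w (rshift m i) < w (rshift m j)).
Proof. by rewrite !std_hiE !stdhi_valE ltn_stdcnt //; apply: rshift_injn. Qed.

Lemma asc_lshift i : asc w (lshift n i) = asc (std_lo w) i + nabove (w (lshift n i)).
Proof.
rewrite /asc /nabove -(card_imset _ (@lshift_injn m n)) -(card_imset _ (@perm_inj _ w^-1)%g).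
rewrite -(cardsID [set j : 'I_(m + n) | j < m]).
congr (_ + _); apply: eq_card => j.
  rewrite !inE; apply/andP/imsetP => [[/andP [h1 h2] h3]|[j' + ->]].
    exists (Ordinal h3); last exact: val_inj.
    rewrite inE h1 std_lo_mono (_ : lshift n (Ordinal h3) = j) //; exact: val_inj.
  by rewrite inE std_lo_mono => /andP [h ->] /=; rewrite h ltn_ord.
rewrite !inE -leqNgt; apply/andP/imsetP => [[h1 /andP [h2 h3]]|[a + ->]].
  by exists (w j); rewrite ?permK // inE hW h1.
rewrite inE permKV => /andP [aA ->]; rewrite andbT.
by move: aA; rewrite -{1}(permKV w a) hW /= => h; split=> //; have := ltn_ord i; lia.
Qed.

Lemma asc_rshift i : asc w (rshift m i) = asc (std_hi w) i.
Proof.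
rewrite /asc -[RHS](card_imset _ (@rshift_injn m n)).
apply: eq_card => j; rewrite !inE; apply/andP/imsetP => [[h1 h2]|[j' + ->]].
  have hj : j - m < n by have := ltn_ord j; move: h1 => /=; lia.
  have e : rshift m (Ordinal hj) = j by apply: val_inj => /=; move: h1 => /=; lia.
  by exists (Ordinal hj) => //; rewrite inE std_hi_mono e h2 andbT /=; move: h1 => /=; lia.
by rewrite inE std_hi_mono => /andP [h ->] /=; rewrite ltn_add2l h.
Qed.

(** The row shift in [embv] is standardization, since the elements of [A] below a value are the
    smaller letters among the last [n]. [std_hi_nbelow] does the same for [embA]. *)
Lemma std_lo_nbelow i :
  w (lshift n i) - #|[set a in A | (a < w (lshift n i))%N]| = std_lo w i.
Proof.
rewrite std_loE /stdlo_val; congr (_ - _).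
rewrite -[RHS](card_imset _ (@perm_inj _ w)); apply: eq_card => a.
rewrite inE; apply/idP/imsetP => [/andP [aA h]|[j + ->]].
  by exists ((w^-1)%g a); rewrite ?inE permKV // h -hW permKV aA.
by rewrite inE hW.
Qed.

Lemma std_hi_nbelow i :
  w (rshift m i) - #|[set b | (b \notin A) && (b < w (rshift m i))%N]| = std_hi w i.
Proof.
rewrite std_hiE /stdhi_val; congr (_ - _).
rewrite -[RHS](card_imset _ (@perm_inj _ w)); apply: eq_card => a.
rewrite inE; apply/idP/imsetP => [/andP [aA h]|[j + ->]].
  by exists ((w^-1)%g a); rewrite ?inE permKV // h -(permKV w a) hW in aA *; rewrite ltnNge permK aA.
by rewrite inE hW -ltnNge.
Qed.

End Shuffled.

Lemma nbelow_nabove (k : 'I_(m + n)) :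
  #|A| = n -> #|[set a in A | (a < k)%N]| + (k \in A) + nabove k = n.
Proof.
move=> cardA; rewrite -[in RHS]cardA (cardsD1 k A) /nabove -(cardsID [set a : 'I_(m + n) | a < k] (A :\ k)).
rewrite -addnAC [LHS]addnC; congr (_ + _); congr (_ + _); apply: eq_card => a; rewrite !inE.
  by case: eqVneq => [->|]; rewrite ?ltnn ?andbF //= andbC.
by rewrite -leqNgt [k < a]ltn_neqAle -val_eqE /= eq_sym; case: (val a == k); case: (a \in A); rewrite ?andbF ?andbT.
Qed.

End Shuffle.

(** * Sums of irreducible characters with prescribed kernel *)

Lemma sum_irr_quo (gT : finGroupType) (G H : {group gT}) x : (H <| G)%g -> x \in G ->
  (\sum_(i | H \subset cfker 'chi[G]_i) 'chi_i 1%g * 'chi_i x)%R = (#|G : H|%g%:R *+ (x \in H))%R.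
Proof.
(* Inflation is a bijection from the irreducible characters of [G / H] to those with [H] in the
   kernel, so the sum is a value of the regular character of [G / H]. *)
move=> nsHG Gx; rewrite (reindex _ (mod_Iirr_bij nsHG)) /=.
transitivity (cfReg (G / H)%g (coset H x)).
  rewrite cfReg_sum sum_cfunE; apply: eq_big => [i | i _]; rewrite mod_IirrE ?cfker_mod //.
  by rewrite !cfModE // cfunE morph1.
rewrite cfRegE card_quotient ?normal_norm //.
by rewrite (sameP eqP (kerP _ (subsetP (normal_norm nsHG) x Gx))) ker_coset.
Qed.

Section Supercharacters.
Variable F : finFieldType.
Local Open Scope ring_scope.
Notation q := (#|F|%:R : algC).

Section Supported.
Variable N : nat.
Notation pos := ('I_N * 'I_N)%type.
Implicit Types (S T : {set pos}) (x : MG F N).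

Definition entry x (p : pos) : F := (x : 'M[F]_(N, N)) p.1 p.2.

Definition supp S : {set MG F N} :=
  [set x : MG F N | [forall i : 'I_N, forall j : 'I_N,
     ((x : 'M[F]_(N, N)) i j != 0) ==> ((i, j) \in S)]].

Lemma suppP S x : reflect (forall p, p \notin S -> entry x p = 0) (x \in supp S).
Proof.
rewrite inE; apply: (iffP forallP) => [h [i j]|h i].
  have /forallP/(_ j)/implyP h' := h i => nS.
  by apply/eqP; apply: contraNT nS => /h'.
by apply/forallP=> j; apply/implyP; apply: contraR => /h /eqP.
Qed.

Lemma entryM x y p : entry (x * y)%g p = entry x p + entry y p.
Proof. by rewrite /entry MG_mulE mxE. Qed.

Lemma supp_group S : group_set (supp S).
Proof.
apply/group_setP; split; first by apply/suppP => p _; rewrite /entry mxE.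
by move=> x y /suppP hx /suppP hy; apply/suppP => p pS; rewrite entryM hx ?hy ?addr0.
Qed.
Canonical supp_Group S := Group (supp_group S).

Definition upper : {set pos} := [set p : pos | (p.1 < p.2)%N].

Lemma ut_supp : ut F N = supp upper :> {set MG F N}.
Proof.
apply/setP=> x; apply/idP/suppP => [|h].
  rewrite inE => /forallP h [i j]; rewrite inE /= -leqNgt.
  by have /forallP/(_ j)/implyP h' := h i => /h'/eqP.
rewrite inE; apply/forallP=> i; apply/forallP=> j; apply/implyP=> ji.
by apply/eqP/(h (i, j)); rewrite inE -leqNgt.
Qed.

Lemma supp_sub S T : S \subset T -> supp S \subset supp T.
Proof.
move=> /subsetP st; apply/subsetP=> x /suppP h; apply/suppP=> p pT; apply: h.
by apply: contra pT; apply: st.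
Qed.

Lemma sum_supp_prod S (h : pos -> F -> algC) :
  \sum_(x in supp S) \prod_(p in S) h p (entry x p) = \prod_(p in S) \sum_y h p y.
Proof.
(* The default [0] makes the functions in the expansion vanish off [S], so that they correspond to
   the matrices of [supp S]. *)
rewrite (big_distr_big_dep (0 : F)) /=.
rewrite (reindex_onto (fun f : {ffun pos -> F} => \matrix_(i, j) f (i, j) : MG F N)
                 (fun x => [ffun p => entry x p])) /=; last first.
  by move=> x _; apply/matrixP=> i j; rewrite mxE ffunE.
have e (f : {ffun pos -> F}) p : entry (\matrix_(i, j) f (i, j) : MG F N) p = f p.
  by rewrite /entry mxE -surjective_pairing.
apply: eq_big => [f|f _]; last by apply: eq_bigr => p _; rewrite e.
have -> : [ffun p => entry (\matrix_(i, j) f (i, j) : MG F N) p] == f.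
  by apply/eqP/ffunP=> p; rewrite ffunE e.
rewrite andbT; apply/suppP/pfamilyP => [h'|[h' _] p pS].
  split=> //; apply/subsetP=> p; rewrite inE; apply: contraR => /h'.
  by rewrite e => ->.
by rewrite e; apply/eqP; apply: contraR pS => /(subsetP h').
Qed.

Lemma card_supp S : #|supp S| = (#|F| ^ #|S|)%N.
Proof.
apply/eqP; rewrite -(eqr_nat algC) natrX.
have := sum_supp_prod S (fun _ _ => 1); rewrite [RHS]prodr_const [X in _ = X ^+ _]sumr_const big1_eq => <-.
by rewrite sumr_const.
Qed.

(** The group is abelian, so [supp S] is normal. Its index gives one [q] per position outside [S],
    and membership of [x] is one vanishing condition per such position. *)
Lemma sum_irr_supp S x : S \subset upper -> x \in ut F N ->
  \sum_(i | supp S \subset cfker 'chi[ut F N]_i) 'chi_i 1%g * 'chi_i x =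
  \prod_(p in upper :\: S) (q *+ (entry x p == 0)).
Proof.
move=> sU xU; have nsS : (supp_Group S <| ut F N)%g.
  rewrite -sub_abelian_normal ?ut_supp ?supp_sub //.
  apply/centsP=> y _ z _; apply/matrixP=> i j; rewrite !MG_mulE !mxE; exact: addrC.
rewrite (sum_irr_quo nsS xU) -divgS ?normal_sub //= ut_supp !card_supp.
have -> : (#|F| ^ #|upper| %/ #|F| ^ #|S|)%N = (#|F| ^ #|upper :\: S|)%N.
  by rewrite -expnB ?cardsDS ?subset_leq_card //; apply/card_gt0P; exists 0.
case: suppP => h.
  rewrite (eq_bigr (fun _ => q)) ?prodr_const ?natrX // => p; rewrite inE => /andP [pS _].
  by rewrite h ?eqxx.
have [p pU px] : exists2 p, p \in upper :\: S & entry x p != 0.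
  apply/exists_inP; apply: contraPT h; rewrite negb_exists_in => /forall_inP h; case=> p pS.
  have [pU|pU] := boolP (p \in upper); first by apply/eqP; rewrite -[_ == _]negbK; apply: h; rewrite inE pS.
  by move: xU; rewrite ut_supp => /suppP; apply.
by rewrite (bigD1 p) //= (negbTE px) mulr0n mul0r.
Qed.

Definition rows (t : 'I_N -> nat) : {set pos} :=
  [set p : pos | (p.1 < p.2 <= p.1 + t p.1)%N].

Lemma ut_wE w : ut_w F w = supp (rows (iot w)).
Proof.
apply/setP=> x; rewrite !inE; apply: eq_forallb => i; apply: eq_forallb => j.
by rewrite !inE /= leq_subLR.
Qed.

(** The group law is addition and a matrix is the sum of its single-entry parts, so inclusion can be
    tested one position at a time. *)
Lemma supp_sub_group S (K : {group MG F N}) :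
  (supp S \subset K) = [forall p in S, supp [set p] \subset K].
Proof.
apply/idP/forall_inP => [h p pS|h]; first by apply: subset_trans h; apply: supp_sub; rewrite sub1set.
apply/subsetP=> x /suppP hx.
pose e p : MG F N := entry x p *: delta_mx p.1 p.2.
have ex : x = (\prod_p e p)%g.
  rewrite [LHS]matrix_sum_delta pair_bigA /=.
  exact: (big_morph (fun y : MG F N => y : 'M[F]_(N, N)) (@MG_mulE F N) (erefl _)).
rewrite ex; apply: group_prod => p _; have [pS|pS] := boolP (p \in S); last first.
  by rewrite /e hx // scale0r; exact: group1.
apply: (subsetP (h p pS)); apply/suppP => -[i j]; rewrite inE /entry !mxE /=.
by rewrite [p]surjective_pairing xpair_eqE; case: (_ && _); rewrite /= ?mulr0.
Qed.

Lemma supp_subset S T : (supp S \subset supp T) = (S \subset T).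
Proof.
apply/idP/idP => [/subsetP h|]; last exact: supp_sub.
apply/subsetP=> p pS; have := h (delta_mx p.1 p.2 : MG F N).
have de p' : entry (delta_mx p.1 p.2 : MG F N) p' = (p' == p)%:R.
  by rewrite /entry mxE; case: p p' {pS} => [? ?] [? ?]; rewrite xpair_eqE.
move=> /(_ _) h'; apply: contraT => pT.
have /suppP/(_ p pT) : (delta_mx p.1 p.2 : MG F N) \in supp T.
  apply: h'; apply/suppP => p'; rewrite de; case: eqVneq => // ->.
  by rewrite pS.
by rewrite de eqxx => /eqP; rewrite oner_eq0.
Qed.

End Supported.

(** In use, [c] is the first column after the part of a row that belongs to [ut_w]; if that part
    reaches the end of the row, [c] is [N] and no column is critical. *)
Definition factor (c j : nat) (y : F) : algC :=
  if (j < c)%N then 1 else q *+ (y == 0) - (j == c)%:R.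

(** * Product formula for the supercharacters *)

Section Formula.
Variable N : nat.
Notation pos := ('I_N * 'I_N)%type.

Definition segment (k : 'I_N) (t : nat) : {set pos} :=
  [set p : pos | (p.1 == k) && (k < p.2 <= k + t)%N].

Lemma supp_rows_sub t (K : {group MG F N}) :
  (supp (rows t) \subset K) = [forall k, supp (segment k (t k)) \subset K].
Proof.
rewrite supp_sub_group; apply/forall_inP/forallP => [h k|h [i j]].
  rewrite supp_sub_group; apply/forall_inP => -[i j]; rewrite inE /= => /andP [/eqP -> kj].
  by apply: h; rewrite inE.
rewrite inE /= => ij; have := h i; rewrite supp_sub_group => /forall_inP; apply.
by rewrite inE eqxx.
Qed.

Lemma segment_sub k t t' : (t <= t')%N -> segment k t \subset segment k t'.
Proof.
move=> tt'; apply/subsetP => -[i j]; rewrite !inE /= => /andP [-> /andP [-> /=]].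
by move/leq_trans; apply; rewrite leq_add2l.
Qed.

Lemma rows_sub (w : 'S_N) t : (rows (iot w) \subset rows t) = [forall k, iot w k <= t k]%N.
Proof.
apply/subsetP/forallP => [h k|h [i j]]; last first.
  rewrite !inE /= => /andP [-> /=] /leq_trans; apply; by rewrite leq_add2l.
case: (posnP (iot w k)) => [-> //|k_gt0].
have hN : (k + iot w k < N)%N.
  by have := iot_asc w ((w^-1)%g k); rewrite permKV; have := ltn_ord k; lia.
have := h (k, Ordinal hN); rewrite !inE /= leqnn leq_add2l andbT -[X in (X < _)%N]addn0 ltn_add2l k_gt0.
by move=> /(_ isT) /andP [].
Qed.

(** A lattice member not contained in [ut_w] has at least one more column in some row; conversely,
    lengthening one row by one column gives a lattice member by [iot_surj]. *)
Lemma largest_in_kerE (w : 'S_N) (psi : 'CF(ut F N)) :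
  largest_in_ker w psi =
  [forall k, (supp (segment k (iot w k)) \subset cfker psi) &&
    ~~ (((k + iot w k).+1 < N)%N && (supp (segment k (iot w k).+1) \subset cfker psi))].
Proof.
rewrite /largest_in_ker ut_wE (supp_rows_sub _ (cfker_group psi)).
apply/andP/forallP => [[/forallP h1 /forallP h2] k|h].
  rewrite h1 /=; apply/negP => /andP [kN hk].
  pose c i := (iot w i + (i == k))%N.
  have [v hv] : exists v : 'S_N, iot v =1 c.
    apply: iot_surj => i; rewrite /c; case: eqVneq => [->|_]; first by rewrite addn1 addSn addnC.
    by have := iot_asc w ((w^-1)%g i); rewrite permKV; have := ltn_ord i; lia.
  have /implyP := h2 v; rewrite !ut_wE (supp_rows_sub _ (cfker_group psi)) supp_subset rows_sub.
  have -> : [forall i, supp (segment i (iot v i)) \subset cfker psi].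
    apply/forallP=> i; rewrite hv /c; case: eqVneq => [->|_]; last by rewrite addn0.
    by rewrite addn1.
  by move=> /(_ isT) /forallP /(_ k); rewrite hv /c eqxx addn1 ltnn.
split; first by apply/forallP=> k; have /andP [] := h k.
apply/forallP=> v; apply/implyP; rewrite !ut_wE (supp_rows_sub _ (cfker_group psi)) => /forallP hv.
rewrite supp_subset rows_sub; apply/forallP=> k; rewrite leqNgt; apply/negP => lt_wv.
have /andP [_ /negP] := h k; apply; apply/andP; split.
  by have := iot_asc v ((v^-1)%g k); rewrite permKV; have := ltn_ord k; lia.
by apply: subset_trans (hv k); apply: supp_sub; apply: segment_sub.
Qed.

(* Moebius inversion over the rows: [J] is the set of rows kept at the level of [w],
   the other ones being enlarged by one column. *)
Lemma superchar_prod (w : 'S_N) (x : MG F N) : x \in ut F N ->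
  superchar F w x =
  \prod_(p in upper N) factor (p.1 + iot w p.1).+1 p.2 (entry x p).
Proof.
move=> xU; pose ok (k : 'I_N) := ((k + iot w k).+1 < N)%N.
pose t (J : {set 'I_N}) (k : 'I_N) := (if k \in J then iot w k else (iot w k).+1).
pose R (k : 'I_N) u := \prod_(j : 'I_N | (k + u < j)%N) (q *+ (entry x (k, j) == 0)).
have rowsE J : \prod_(p in upper N :\: rows (t J)) (q *+ (entry x p == 0)) = \prod_(k : 'I_N) R k (t J k).
  rewrite pair_big_dep /=; apply: eq_big => [[i j]|[i j] _] //.
  rewrite !inE /=; rewrite /t; case: ifP => _; lia.
transitivity (\sum_(J : {set 'I_N}) \prod_k (if k \in J then R k (iot w k) else - (ok k)%:R * R k (iot w k).+1)).
  transitivity (\sum_(J : {set 'I_N}) (\prod_k (if k \in J then 1 else - (ok k)%:R)) *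
      \sum_(i | supp (rows (t J)) \subset cfker 'chi[ut F N]_i) 'chi_i 1%g * 'chi_i x); last first.
    apply: eq_bigr => J _; rewrite sum_irr_supp //; last first.
      by apply/subsetP => -[i j]; rewrite !inE => /andP [].
    rewrite rowsE -big_split /=; apply: eq_bigr => k _.
    by rewrite /t; case: ifP => _; rewrite ?mul1r.
  rewrite /superchar sum_cfunE big_mkcond /=.
  under [RHS]eq_bigr => J _ do rewrite [X in _ * X]big_mkcond big_distrr /=.
  rewrite exchange_big /=; apply: eq_bigr => i _.
  transitivity ((largest_in_ker w 'chi_i)%:R * ('chi_i 1%g * 'chi_i x)).
    by case: ifP; rewrite ?mul0r // mul1r cfunE.
  pose P k u := supp (segment k u) \subset cfker 'chi_i.
  (* A kernel containing the longer segment contains the shorter one, so the indicator of each row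
     condition is a difference of two indicators. *)
  rewrite (_ : _%:R = \prod_k ((P k (iot w k))%:R - (ok k && P k (iot w k).+1)%:R)); last first.
    rewrite largest_in_kerE -/(P _ _).
    have e k : ((P k (iot w k))%:R - (ok k && P k (iot w k).+1)%:R : algC) =
      (P k (iot w k) && ~~ (ok k && P k (iot w k).+1))%:R.
      have : P k (iot w k).+1 -> P k (iot w k).
        by apply: subset_trans; apply: supp_sub; apply: segment_sub.
      by case: (ok k); case: (P k (iot w k).+1) => /= [/(_ isT) ->|_]; rewrite ?subrr ?subr0 ?andbT.
    rewrite (eq_bigr _ (fun k _ => e k)).
    case: forallP => [h|h].
      by rewrite big1 // => k _; rewrite (h k).
    have [k hk] : exists k, ~~ (P k (iot w k) && ~~ (ok k && P k (iot w k).+1)).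
      by apply/existsP; rewrite -negb_forall; apply/forallP.
    by rewrite (bigD1 k) //= (negbTE hk) mul0r.
  rewrite bigA_distr big_distrl /=; apply: eq_bigr => J _.
  rewrite (supp_rows_sub _ (cfker_group _)).
  transitivity ((\prod_k (if k \in J then 1 else - (ok k)%:R) * \prod_k (P k (t J k))%:R) * ('chi_i 1%g * 'chi_i x)).
    congr (_ * _); rewrite -big_split /=; apply: eq_bigr => k _.
    by rewrite /t; case: ifP => _; rewrite ?mul1r // mulNr -natrM mulnb.
  rewrite -mulrA; congr (_ * _).
  case: forallP => [h|h].
    by rewrite big1 ?mul1r // => k _; rewrite /P (h k).
  have [k hk] : exists k, ~~ P k (t J k).
    by apply/existsP; rewrite -negb_forall; apply/forallP.
  by rewrite (bigD1 k) //= (negbTE hk) !mul0r.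
(* For fixed [x] the summand factors over the rows, so the sum over [J] folds back into a product of
   two-term sums. *)
rewrite -bigA_distr.
transitivity (\prod_(k : 'I_N) \prod_(j : 'I_N | (k < j)%N) factor (k + iot w k).+1 j (entry x (k, j))); last first.
  by rewrite pair_big_dep /=; apply: eq_big => [[i j]|[i j] _] //; rewrite !inE.
apply: eq_bigr => k _.
have cut (G : 'I_N -> algC) : (forall j : 'I_N, (j <= k + iot w k)%N -> G j = 1) ->
    \prod_(j : 'I_N | (k < j)%N) G j = \prod_(j : 'I_N | (k + iot w k < j)%N) G j.
  move=> hG; rewrite big_mkcond [RHS]big_mkcond; apply: eq_bigr => j _.
  case: (leqP j (k + iot w k)) => [/hG ->|hj]; first by case: ifP.
  by rewrite (_ : (k < j)%N) //; lia.
rewrite cut => [|j hj]; last by rewrite /factor ltnS hj.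
rewrite /= /R; have [okk|nok] := boolP (ok k); last first.
  rewrite mulr0n oppr0 mul0r /= addr0; apply: eq_bigr => j hj.
  by move: nok; rewrite /ok; have := ltn_ord j; lia.
have tail : \prod_(j : 'I_N | (k + (iot w k).+1 < j)%N) (q *+ (entry x (k, j) == 0)) =
    \prod_(j : 'I_N | (k + iot w k < j)%N && (j != Ordinal okk)) (q *+ (entry x (k, j) == 0)).
  by apply: eq_bigl => j; rewrite -val_eqE /=; lia.
(* Both terms share the columns after the critical one; factoring these out leaves [q [y = 0] - 1]
   at the critical column. *)
rewrite (bigD1 (Ordinal okk)) //= [RHS](bigD1 (Ordinal okk)) //= tail.
rewrite [\prod_(_ | _) factor _ _ _](_ : _ = \prod_(j : 'I_N | (k + iot w k < j)%N && (j != Ordinal okk)) (q *+ (entry x (k, j) == 0))); last first.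
  apply: eq_bigr => j; rewrite -val_eqE /= => /andP [h1 /negbTE h2].
  by rewrite /factor h2 subr0 ltnS leqNgt h1.
by rewrite -mulrDl /factor /= ltnn eqxx.
Qed.

End Formula.

(** * Averages over a single entry *)

Definition weight (y : F) : algC := if y != 0 then (-1) / (q - 1) else 1.

Lemma card_gt1R : 1 < q.
Proof. by rewrite (ltr_nat algC 1); apply: finRing_gt1. Qed.

Lemma card_neq0 : q != 0.
Proof. by rewrite gt_eqF // (lt_trans ltr01 card_gt1R). Qed.

Lemma sum_pred0 (h : F -> algC) : \sum_y h y * (q *+ (y == 0)) = h 0 * q.
Proof.
rewrite (bigD1 0) //= eqxx big1 ?addr0 // => y /negbTE ->; exact: mulr0.
Qed.

Lemma sum_weight : \sum_y weight y = 0.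
Proof.
rewrite (bigD1 0) //= {1}/weight eqxx /= (eq_bigr (fun _ => (-1) / (q - 1))); last first.
  by move=> y y0; rewrite /weight y0.
have /(congr1 (fun k => k%:R : algC)) : #|[pred y : F | y != 0]|.+1 = #|F|.
  by rewrite [RHS](cardD1 0) inE add1n; congr _.+1; apply: eq_card => y; rewrite !inE andbT.
rewrite -natr1 => /(canRL (addrK _)) e.
by rewrite sumr_const (eq_card (B := [pred y : F | y != 0])) // -[X in _ + X]mulr_natr e mulrAC -mulrA divff ?mulr1 ?subrr // subr_eq0 gt_eqF ?card_gt1R.
Qed.

Lemma average_factor c j : q^-1 * \sum_y factor c j (y : F) = (j != c)%:R.
Proof.
rewrite /factor; case: ltngtP => [jc|jc|_]; rewrite ?sumr_const ?mulVf ?card_neq0 //.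
  under eq_bigr => y _ do rewrite subr0 -[X in X *+ _]mul1r -mulrnAr.
  by rewrite (sum_pred0 (fun _ => 1)) mul1r mulVf ?card_neq0.
rewrite big_split /= sumr_const.
under eq_bigr => y _ do rewrite -[X in X *+ _]mul1r -mulrnAr.
by rewrite (sum_pred0 (fun _ => 1)) mul1r mulNrn subrr mulr0.
Qed.

(** The weights sum to 0, which kills constants: nothing survives before the critical column, and
    from there on only [q [y = 0]] counts, with [weight 0] equal to 1. *)
Lemma average_weight_factor c j :
  q^-1 * \sum_y weight y * factor c j (y : F) = (c <= j)%:R.
Proof.
rewrite /factor; case: ltnP => jc.
  by under eq_bigr => y _ do rewrite mulr1; rewrite sum_weight mulr0.
under eq_bigr => y _ do rewrite mulrBr.
rewrite sumrB sum_pred0 -big_distrl /= sum_weight mul0r subr0.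
by rewrite /weight eqxx mul1r mulVf ?card_neq0.
Qed.

(** In this form the critical column compares directly with [cA], which is [N] minus [nabove]. *)
Lemma iot_critical N (w : 'S_N) i : ((w i + iot w (w i)).+1 = N - asc w i)%N.
Proof. by have := iot_asc w i; have := ltn_ord (w i); lia. Qed.

Lemma asc_le N (w : 'S_N) i : (asc w i <= N)%N.
Proof. by have := iot_asc w i; lia. Qed.

Lemma factor_shift c j t (y : F) : factor (c + t) (j + t) y = factor c j y.
Proof. by rewrite /factor ltn_add2r eqn_add2r. Qed.

(** * Delapsing a product of local factors *)

Section Product.
Variables (m n : nat) (A : {set 'I_(m + n)}).
Notation N := (m + n)%N.
Notation pos := ('I_(m + n)%N * 'I_(m + n)%N)%type.

Lemma getmE p (M : 'M[F]_(p, p)) (i j : 'I_p) : getm M i j = M i j.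
Proof. by rewrite /getm !valK. Qed.

Lemma embv_supp (u' : 'M[F]_(m, m)) : embv A u' \in supp (Uv_A A).
Proof. by apply/suppP => -[i j]; rewrite /entry mxE /= => /negbTE ->. Qed.

Lemma embA_supp (u : 'M[F]_(n, n)) : embA A u \in supp (U_A A).
Proof. by apply/suppP => -[i j]; rewrite /entry mxE /= => /negbTE ->. Qed.

Lemma prod_upper (h : pos -> algC) :
  \prod_(p in upper N) h p =
  \prod_(p in L_A A) h p * \prod_(p in R_A A) h p * \prod_(p in Uv_A A) h p * \prod_(p in U_A A) h p.
Proof.
rewrite (bigID (fun p : pos => p.1 \in A)) /= (bigID (fun p : pos => (p.2 < cA A p.1)%N)) /=.
rewrite [X in _ * X](bigID (fun p : pos => (p.2 < cA A p.1)%N)) /=.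
rewrite mulrAC [X in _ * X * _]mulrC !mulrA.
by congr (_ * _ * _ * _); apply: eq_bigl => p; rewrite !inE -?leqNgt.
Qed.

(** The four position sets partition the upper triangle, so each entry of the argument comes from a
    single summand and the product splits. The sums over [l] and [r] factor entry by entry, each
    entry taking one [q^-1] from the normalization. *)
Lemma Dela_prod (h : pos -> F -> algC) (g : 'CF(ut F N)) u' u :
  (forall x, x \in ut F N -> g x = \prod_(p in upper N) h p (entry x p)) ->
  Dela A g u' u =
  (\prod_(p in L_A A) (q^-1 * \sum_y h p y)) * (\prod_(p in R_A A) (q^-1 * \sum_y weight y * h p y)) *
  \prod_(p in Uv_A A) h p (entry (embv A u') p) * \prod_(p in U_A A) h p (entry (embA A u) p).
Proof.
move=> hg; rewrite /Dela.
transitivity (q ^- (#|L_A A| + #|R_A A|) *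
  \sum_(l in supp (L_A A)) \sum_(r in supp (R_A A))
    (\prod_(p in L_A A) h p (entry l p) * \prod_(p in R_A A) (weight (entry r p) * h p (entry r p))) *
    (\prod_(p in Uv_A A) h p (entry (embv A u') p) * \prod_(p in U_A A) h p (entry (embA A u) p))); last first.
  rewrite !big_split /= !prodr_const exprVn exprVn exprD invfM -!sum_supp_prod.
  under eq_bigr => l _ do rewrite -big_distrl -big_distrr /=.
  rewrite -!big_distrl /= mulrA -!mulrA; congr (_ * _).
  by rewrite [RHS]mulrCA.
congr (_ * _); apply: eq_bigr => l lL; apply: eq_bigr => r rR.
have /suppP hl := lL; have /suppP hr := rR.
have /suppP hv := embv_supp u'; have /suppP hu := embA_supp u.
set x : MG F N := (_ + _ : 'M[F]_(N, N)).
have ex p : entry x p = entry l p + entry (embv A u') p + entry (embA A u) p + entry r p.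
  by rewrite /x /entry !mxE.
rewrite hg; last first.
  rewrite ut_supp; apply/suppP => p; rewrite inE => /negbTE pU.
  by rewrite ex hl ?hr ?hv ?hu ?addr0 // !inE pU.
rewrite prod_upper.
have -> : ((-1) / (q - 1)) ^+ #|[set p : pos | (r : 'M[F]_(N, N)) p.1 p.2 != 0]| =
    \prod_(p in R_A A) weight (entry r p).
  rewrite -prodr_const [LHS]big_mkcond [RHS]big_mkcond /=; apply: eq_bigr => p _.
  rewrite inE -/(entry r p) /weight; case: (boolP (p \in R_A A)) => [//|/hr ->].
  by rewrite eqxx.
rewrite big_split /= -!mulrA mulrCA; congr (_ * _).
  apply: eq_bigr => p pL; rewrite ex hv ?hu ?hr ?addr0 //.
  - by move: pL; rewrite !inE => /andP [/andP [-> ->]].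
  - by move: pL; rewrite !inE => /andP [/andP [-> ->]]; rewrite /= -ltnNge.
  - by move: pL; rewrite !inE => /andP [/andP [-> ->]].
congr (_ * (_ * (_ * _))).
- apply: eq_bigr => p pL; rewrite ex hv ?hu ?hl ?addr0 ?add0r //.
  + by move: pL; rewrite !inE => /andP [/andP [-> /negbTE ->]].
  + by move: pL; rewrite !inE => /andP [/andP [-> /negbTE ->]].
  + by move: pL; rewrite !inE => /andP [/andP [-> ->]]; rewrite -leqNgt.
- apply: eq_bigr => p pL; rewrite ex hl ?hu ?hr ?addr0 ?add0r //.
  + by move: pL; rewrite !inE => /andP [/andP [-> ->]]; rewrite /= -ltnNge.
  + by move: pL; rewrite !inE => /andP [/andP [-> /negbTE ->]].
  + by move: pL; rewrite !inE => /andP [/andP [-> /negbTE ->]].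
- apply: eq_bigr => p pL; rewrite ex hl ?hv ?hr ?addr0 ?add0r //.
  + by move: pL; rewrite !inE => /andP [/andP [-> ->]].
  + by move: pL; rewrite !inE => /andP [/andP [-> ->]].
  + by move: pL; rewrite !inE => /andP [/andP [-> ->]]; rewrite /= -leqNgt.
Qed.

(* [cA] elaborates its size bound as a sum in the ring of natural numbers,
   which [lia] does not recognize. *)
Lemma cAE k : cA A k = (N - nabove A k)%N.
Proof. by []. Qed.

Lemma nabove_le (k : 'I_N) : (nabove A k + k < N)%N.
Proof.
have : (nabove A k <= #|[set v : 'I_N | k.+1 <= v]|)%N.
  by apply: subset_leq_card; apply/subsetP => v; rewrite !inE => /andP [].
by rewrite card_ord_ge; have := ltn_ord k; lia.
Qed.

Variable w : 'S_N.
Hypothesis cardA : #|A| = n.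

(** By contraposition: for a nonzero value no average over [L_A] or [R_A] vanishes, which gives the
    two inequalities of [sorted_of_asc]. *)
Lemma Dela_superchar0 u' u :
  [set i | w i \in A] != [set i : 'I_N | (m <= i)%N] -> Dela A (superchar F w) u' u = 0.
Proof.
move=> notsh; apply: contraNeq notsh.
rewrite (Dela_prod (h := fun p => factor (p.1 + iot w p.1).+1 p.2) _ _ (@superchar_prod N w)) /=.
rewrite !mulf_eq0 !negb_or => /andP [/andP [/andP [/prodf_neq0 nL /prodf_neq0 nR] _] _].
apply/eqP; apply: (shuffle_of_sorted cardA); apply: sorted_of_asc => i iA.
- rewrite leqNgt; apply/negP => lt_asc.
  (* With too many ascents, the critical column [N - asc w i] falls inside [L_A], where its average
     is 0. *)
  have hN : (N - asc w i < N)%N by have := ltn_ord (w i); lia.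
  have lt2 : (N - asc w i < N - nabove A (w i))%N by have := iot_critical w i; lia.
  have /nL : (w i, Ordinal hN) \in L_A A.
    rewrite inE /= iA andbT; apply/andP; split; last (rewrite cAE; exact: lt2).
    by rewrite -iot_critical ltnS leq_addr.
  by rewrite average_factor /= iot_critical eqxx eqxx.
- rewrite leqNgt; apply/negP => lt_asc.
  (* With too few ascents, the first column of this row of [R_A] comes before the critical one, so
     its average is 0. *)
  have hN : (N - nabove A (w i) < N)%N by have := ltn_ord (w i); lia.
  have lt2 : (w i < N - nabove A (w i))%N by have := nabove_le (w i); lia.
  have /nR : (w i, Ordinal hN) \in R_A A.
    rewrite inE /= iA andbT; apply/andP; split; [exact: lt2|by rewrite cAE].
  by rewrite average_weight_factor /= iot_critical (_ : (_ <= _)%N = false) ?eqxx //; lia.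
Qed.

Lemma prod_shift (M p a t : nat) (G : nat -> algC) : (p + t <= M)%N ->
  \prod_(j < M | (a + t < j)%N && (j < p + t)%N) G j = \prod_(j < p | (a < j)%N) G (j + t)%N.
Proof.
move=> leM; rewrite -big_ord_widen_cond //.
transitivity (\prod_((a + t).+1 <= j < p + t) G j).
  by rewrite big_geq_mkord.
by rewrite -addSn big_addn addnK big_geq_mkord.
Qed.

Hypothesis hW : forall i, (w i \in A) = (m <= i)%N.

(** Rows are matched through positions of [w]. If [t] elements of [A] lie below row [k], then the
    row index, the column range and the critical column are those of the small matrix shifted by
    [t]. *)
Lemma prod_Uv u' :
  \prod_(p in Uv_A A) factor (p.1 + iot w p.1).+1 p.2 (entry (embv A u') p) =
  \prod_(p in upper m) factor (p.1 + iot (std_lo w) p.1).+1 p.2 (entry (u' : MG F m) p).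
Proof.
transitivity (\prod_(k : 'I_N | k \notin A) \prod_(j : 'I_N | (k < j)%N && (j < cA A k)%N)
    factor (k + iot w k).+1 j (entry (embv A u') (k, j))).
  rewrite pair_big_dep /=; apply: eq_big => [[k j]|[k j] _] //.
  by rewrite !inE /= [(_ < _)%N && _]andbC andbA.
transitivity (\prod_(k : 'I_m) \prod_(j : 'I_m | (k < j)%N)
    factor (k + iot (std_lo w) k).+1 j (entry (u' : MG F m) (k, j))); last first.
  by rewrite pair_big_dep /=; apply: eq_big => [[k j]|[k j] _] //; rewrite !inE.
rewrite (reindex_perm w) /= [RHS](reindex_perm (std_lo w)) /=.
rewrite (eq_bigl (fun i : 'I_N => (i < m)%N)) => [|i]; last by rewrite hW -ltnNge.
rewrite big_split_ord /= [X in _ * X]big_pred0 ?mulr1 => [|i]; last by rewrite -ltn_subRL subnn.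
apply: eq_big => [i|i _]; first by rewrite ltn_ord.
rewrite !iot_critical; set k := w _; set r := std_lo w i; set t := #|[set a in A | (a < k)%N]|.
have rE : (k - t)%N = r by apply: std_lo_nbelow.
have kA : k \notin A by rewrite hW -ltnNge /= ltn_ord.
have kE : k = (r + t)%N :> nat.
  rewrite -rE subnK // -(card_ord_lt (ltnW (ltn_ord k))); apply: subset_leq_card.
  by apply/subsetP => a; rewrite !inE => /andP [].
have cE : cA A k = (m + t)%N.
  by have := nbelow_nabove k cardA; rewrite (negbTE kA) cAE -/t; lia.
have critE : (N - asc w (lshift n i) = m - asc (std_lo w) i + t)%N.
  by rewrite (asc_lshift hW) -/k; have := asc_le (std_lo w) i; move: cE; rewrite cAE; lia.
pose G j := factor (m - asc (std_lo w) i + t) j (getm u' r (j - t)).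
transitivity (\prod_(j < N | (r + t < j)%N && (j < m + t)%N) G j).
  apply: eq_big => [j|j /andP [kj jc]]; first by rewrite kE cE.
  by rewrite critE /entry mxE inE /= kj jc kA /= -/t rE.
rewrite prod_shift; last by have := nabove_le k; move: cE; rewrite cAE; lia.
by apply: eq_bigr => j _; rewrite /G factor_shift addnK getmE.
Qed.

Lemma prod_U u :
  \prod_(p in U_A A) factor (p.1 + iot w p.1).+1 p.2 (entry (embA A u) p) =
  \prod_(p in upper n) factor (p.1 + iot (std_hi w) p.1).+1 p.2 (entry (u : MG F n) p).
Proof.
transitivity (\prod_(k : 'I_N | k \in A) \prod_(j : 'I_N | (k < j)%N && (cA A k <= j)%N)
    factor (k + iot w k).+1 j (entry (embA A u) (k, j))).
  rewrite pair_big_dep /=; apply: eq_big => [[k j]|[k j] _] //.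
  by rewrite !inE /= [(_ < _)%N && _]andbC andbA.
transitivity (\prod_(k : 'I_n) \prod_(j : 'I_n | (k < j)%N)
    factor (k + iot (std_hi w) k).+1 j (entry (u : MG F n) (k, j))); last first.
  by rewrite pair_big_dep /=; apply: eq_big => [[k j]|[k j] _] //; rewrite !inE.
rewrite (reindex_perm w) /= [RHS](reindex_perm (std_hi w)) /=.
rewrite (eq_bigl (fun i : 'I_N => (m <= i)%N)) => [|i]; last by rewrite hW.
rewrite big_split_ord /= [X in X * _]big_pred0 ?mul1r => [|i]; last by rewrite leqNgt ltn_ord.
apply: eq_big => [i|i _]; first by rewrite leq_addr.
rewrite !iot_critical; set k := w _; set r := std_hi w i.
have rE : (k - #|[set b | (b \notin A) && (b < k)%N]|)%N = r by apply: std_hi_nbelow.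
have kA : k \in A by rewrite hW leq_addr.
(* Discounting the indices below [k] outside [A] leaves those in [A]. Hence this row of [U_A] starts
   at column [r.+1 + m], just after the diagonal of the small matrix once columns are shifted by
   [m]. *)
have tE : #|[set a in A | (a < k)%N]| = r.
  rewrite -rE -[X in (X - _)%N](card_ord_lt (ltnW (ltn_ord k))) -(cardsID A [set v : 'I_N | (v < k)%N]).
  rewrite -[X in _ = (_ - X)%N](_ : #|[set v : 'I_N | (v < k)%N] :\: A| = _) ?addnK.
    by apply: eq_card => a; rewrite !inE andbC.
  by apply: eq_card => a; rewrite !inE.
have cE : cA A k = (r.+1 + m)%N.
  by have := nbelow_nabove k cardA; rewrite kA tE cAE; have := ltn_ord r; lia.
have le_kc : (k < cA A k)%N by have := nabove_le k; rewrite cAE; lia.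
have critE : (N - asc w (rshift m i) = n - asc (std_hi w) i + m)%N.
  by rewrite asc_rshift; have := asc_le (std_hi w) i; lia.
pose G j := factor (n - asc (std_hi w) i + m) j (getm u r (j - m)).
transitivity (\prod_(j < N | (r + m < j)%N && (j < n + m)%N) G j).
  apply: eq_big => [j|j /andP [kj jc]].
    by move: le_kc; rewrite cE; have := ltn_ord j; lia.
  by rewrite critE /entry mxE inE /= kj jc kA /= rE.
rewrite prod_shift; last by lia.
by apply: eq_bigr => j _; rewrite /G factor_shift addnK getmE.
Qed.

(** For a shuffle, all columns of [L_A] lie before the critical one of their row and all columns of
    [R_A] at or after it, so every average is 1. *)
Lemma Dela_superchar u' u :
  (u' : MG F m) \in ut F m -> (u : MG F n) \in ut F n ->
  Dela A (superchar F w) u' u = tensor (superchar F (std_lo w)) (superchar F (std_hi w)) u' u.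
Proof.
move=> u'U uU; rewrite (Dela_prod (h := fun p => factor (p.1 + iot w p.1).+1 p.2) _ _ (@superchar_prod N w)) /=.
rewrite prod_Uv prod_U /tensor !superchar_prod //.
rewrite [X in X * _ * _ * _]big1 ?mul1r => [|[k j] kjL].
  rewrite [X in X * _ * _]big1 ?mul1r // => -[k j].
  rewrite inE /= => /andP [/andP [_ kA] jc]; rewrite average_weight_factor.
  rewrite -(permKV w k) iot_critical (_ : (_ <= _)%N) //; apply: leq_trans jc.
  by rewrite -{2}(permKV w k) cAE leq_sub2l // nabove_le_asc // permKV.
move: kjL; rewrite inE /= => /andP [/andP [_ kA] jc]; rewrite average_factor /=.
rewrite -(permKV w k) iot_critical (_ : _ != _) // neq_ltn.
apply/orP; left; apply: leq_trans jc _.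
by rewrite -{1}(permKV w k) cAE leq_sub2l // asc_le_nabove // permKV.
Qed.

End Product.

End Supercharacters.

Theorem theorem4p5 (F : finFieldType) (m n : nat) (A : {set 'I_(m + n)})
    (w : 'S_(m + n)) :
  #|A| = n ->
  forall (u' : 'M[F]_(m, m)) (u : 'M[F]_(n, n)),
    (u' : MG F m) \in ut F m -> (u : MG F n) \in ut F n ->
    Dela A (superchar F w) u' u =
      (if [set i | w i \in A] == [set i : 'I_(m + n) | (m <= i)%N]
       then tensor (superchar F (std_lo w)) (superchar F (std_hi w)) u' u
       else 0%R).
Proof.
move=> cardA u' u u'U uU; case: eqP => [sh|/eqP nsh].
  by apply: Dela_superchar => // i; move/setP/(_ i): sh; rewrite !inE.
exact: Dela_superchar0.
Qed.
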